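(* Consider a spherically symmetric spacetime in the setting described in the context, belonging to Case 1 (that is, $\partial_v r_-=0$, so $x_-(v)\equiv 0$). Then the spacetime is either of Type 1 or of Type 2, i.e. the quantities $U^{(\pm)}$ satisfy $-1<U^{(+)}_0<U^{(+)}_\infty\le U^{(-)}_0<+1$, with equality $U^{(+)}_\infty=U^{(-)}_0$ (Type 1) or strict inequality $U^{(+)}_\infty<U^{(-)}_0$ (Type 2).
   Context: Consider a spherically symmetric spacetime with metric $ds^2=-f(v,r)A(v,r)^2dv^2+2A(v,r)\,dr\,dv+r^2d\Omega^2$, where $d\Omega^2$ is the unit 2-sphere metric, $A>0$, $\lim_{r\to\infty}f=\lim_{r\to\infty}A=1$, and $f(v,0)=1$, $\partial_rf(v,0)=0$, $\partial_rA(v,0)=0$. It is assumed that $f(v,\cdot)=0$ has exactly two roots $r_+(v)>r_-(v)$ (the outer and inner apparent horizons, AHs), so $f(v,r)=F(v,r)(r-r_+(v))(r-r_-(v))$ with $F>0$; set $h=AF>0$. Standing assumptions: (1) $\partial_v r_+<0$; (2) $\lim_{v\to\infty}r_\pm(v)=r_c$; (3) the sign of $\partial_v r_-$ never changes; (4) the limits as $v\to\infty$ of $A,F,h$ behave as analytic functions of $r$, so all $\partial_r^n h(v,r)$ converge to finite values as $v\to\infty$; $h_c:=\lim_{v\to\infty}h(v,r_c)$. Put $x=r-r_c$, $x_\pm(v)=r_\pm(v)-r_c$ (so $x_\pm\to 0$), and regard $h$ as a function of $(v,x)$. Radially outgoing null geodesics are the solutions of $dx/dv=\tfrac12 h(v,x)(x-x_+(v))(x-x_-(v))$.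 Compactified outgoing null coordinate: fix $v_0$ and work in $v\ge v_0$; set $U=\frac{2}{\pi}\arctan((v-v_0)/r_c)$ on $\{r=0,\,v\ge v_0\}$ and $U=-\frac{2}{\pi}\arctan(r/r_c)$ on $\{v=v_0,\,r>0\}$, and extend $U$ by requiring it to be constant along each radially outgoing null geodesic; $U$ ranges over $[-1,1]$ ($U=+1$ corresponds to $v=\infty$ on $r=0$, $U=-1$ to $r=\infty$ on $v=v_0$). The outer and inner AHs lie at $U=U^{(\pm)}(v)$; $U^{(\pm)}_0=U^{(\pm)}(v_0)$ and $U^{(\pm)}_\infty=\lim_{v\to\infty}U^{(\pm)}(v)$. A Case 1 spacetime is of Type 1 if $U^{(+)}_\infty=U^{(-)}_0$ and of Type 2 if $U^{(+)}_\infty<U^{(-)}_0$. *)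

(* Defs.v *)
From HB Require Import structures.
From mathcomp Require Import all_boot all_order all_algebra.
From mathcomp Require Import all_classical all_reals all_analysis.
Set Implicit Arguments. Unset Strict Implicit. Unset Printing Implicit Defensive.
Import Order.TTheory GRing.Theory Num.Theory.
Import numFieldNormedType.Exports.
Local Open Scope classical_set_scope.
Local Open Scope ring_scope.

Section Defs.
Variable R : realType.

(* g is a radially outgoing null geodesic r = g(v) on the v-interval [a,b]:
   ds^2 = 0 with dθ = dφ = 0 and outgoing means  dr/dv = f A / 2
   (equivalently dx/dv = h (x - x_+)(x - x_-)/2 with x = r - r_c). *)
Definition outgoing_null_geodesic (f A : R -> R -> R) (a b : R) (g : R -> R) : Prop :=
  {within `[a, b], continuous g} /\
  (forall s, a < s < b -> is_derive s 1 g ((f s (g s) * A s (g s)) / 2)).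

(* Uval rc v0 f A v r u : the compactified outgoing null coordinate U of the
   point (v, r) (v >= v0, r >= 0) has value u.  The outgoing null geodesic
   through (v, r), followed back to the past, either stays in r > 0 down to
   v = v0 (and then U = -(2/pi) atan(r(v0)/rc)), or reaches r = 0 at some
   v = a >= v0 (and then U = (2/pi) atan((a - v0)/rc)). *)
Definition Uval (rc v0 : R) (f A : R -> R -> R) (v r u : R) : Prop :=
  exists (g : R -> R) (a : R),
    [/\ v0 <= a <= v, g v = r, outgoing_null_geodesic f A a v g,
        (forall s, a < s <= v -> 0 < g s) &
        ((a = v0 /\ 0 < g a /\ u = - (2 / pi) * atan (g a / rc)) \/
         (g a = 0 /\ u = (2 / pi) * atan ((a - v0) / rc)))].

Definition Ucoord (rc v0 : R) (f A : R -> R -> R) (v r : R) : R :=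
  xget 0 [set u | Uval rc v0 f A v r u].

End Defs.

(* Main.v *)
Require Import Defs.
From HB Require Import structures.
From mathcomp Require Import all_boot all_order all_algebra.
From mathcomp Require Import all_classical all_reals all_analysis.
From mathcomp Require Import ring lra.
Import Order.TTheory GRing.Theory Num.Theory.
Import numFieldNormedType.Exports.
Local Open Scope classical_set_scope.
Local Open Scope ring_scope.

(* The inner horizon is the constant r = rc, which is itself a null geodesic.
   An outgoing geodesic ending on the outer horizon at time v, followed to the
   past, cannot meet r = rc by uniqueness for the ODE, and stays strictly below
   the outer horizon, since the latter moves inward while the geodesic is
   momentarily at rest on it. It is therefore trapped in a compact region,
   reaches v0, and arrives there at some radius in (rc, rp v0]. Geodesics do not
   cross, so this radius decreases in v; hence U^(+) increases and is bounded by
   the value -1/2 that U takes on r = rc.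
   Existence of the geodesic comes from Picard iteration for the field clamped
   to the trapping rectangle, where it is globally Lipschitz. *)

(** * Mean value bound, primitives and limits with a geometric rate *)

Section Calculus.
Variable R : realType.
Local Set Implicit Arguments.
Local Unset Strict Implicit.
Implicit Types (D B h : R -> R).

(** Both [B - D] and [B + D] have nonnegative derivative, so both are nondecreasing; together they
    bound the increment of [D] from the two sides. *)
Lemma derive_le_bound D B dD dB (a b : R) : a <= b ->
  (forall x, a <= x <= b -> is_derive x 1 D (dD x)) ->
  (forall x, a <= x <= b -> is_derive x 1 B (dB x)) ->
  (forall x, a <= x <= b -> `|dD x| <= dB x) ->
  `|D b - D a| <= B b - B a.
Proof.
move=> ab hD hB hDB.
have mono (E dE : R -> R) : (forall x, a <= x <= b -> is_derive x 1 E (dE x)) ->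
    (forall x, a <= x <= b -> 0 <= dE x) -> E a <= E b.
  move=> hE hE0; apply: (@ger0_derive1_ndecr _ E a b) => //.
  - by move=> x; rewrite in_itv/= => /andP[ax xb]; case: (hE x) => //; rewrite !ltW.
  - move=> x; rewrite in_itv/= => /andP[ax xb].
    have axb : a <= x <= b by rewrite !ltW.
    by rewrite derive1E (@derive_val _ _ _ _ _ _ _ (hE x axb)); exact: hE0.
  - apply: derivable_within_continuous => x; rewrite in_itv/= => axb.
    by case: (hE x axb).
have h1 := mono (B - D) (fun x => dB x - dD x).
have h2 := mono (B + D) (fun x => dB x + dD x).
rewrite ler_norml; apply/andP; split.
- suff : (B + D) a <= (B + D) b by rewrite !fctE; lra.
  apply: h2 => x axb; first by apply: is_deriveD; [exact: hB|exact: hD].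
  by have := hDB x axb; rewrite ler_norml => /andP[]; lra.
- suff : (B - D) a <= (B - D) b by rewrite !fctE; lra.
  apply: h1 => x axb; first by apply: is_deriveB; [exact: hB|exact: hD].
  by have := hDB x axb; rewrite ler_norml => /andP[]; lra.
Qed.

(* The base point -1 makes 0 interior, so the derivative at 0 is two-sided. *)
Definition prim h (x : R) : R :=
  (\int[lebesgue_measure]_(t in `[-1, x]) h t)%R -
  (\int[lebesgue_measure]_(t in `[-1, 0]) h t)%R.

Lemma prim0 h : prim h 0 = 0.
Proof. exact: subrr. Qed.

Lemma is_derive_prim h (x : R) : continuous h -> 0 <= x -> is_derive x 1 (prim h) (h x).
Proof.
move=> hc x0.
have xu : x < x + 1 by lra.
have hi : lebesgue_measure.-integrable `[-1, x + 1] (EFin \o h).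
  apply: continuous_compact_integrable; first exact: segment_compact.
  by apply: continuous_subspaceT.
have m1x : -1 < x by lra.
have [d1 d2] := continuous_FTC1_closed xu hi m1x (hc x).
rewrite /prim -[h x]subr0.
apply: is_deriveB.
by apply: DeriveDef; [exact: d1|rewrite -derive1E d2].
Qed.

(** The tail of the geometric series from [n] is [2 * K / 2 ^+ n], so the intervals of that radius
    around [u n] are nested. The supremum of their left ends lies in all of them, which gives the
    limit together with its rate. *)
Lemma geometric_limit (u : nat -> R) K :
  (forall n, `|u n.+1 - u n| <= K / 2 ^+ n) ->
  exists l, forall n, `|l - u n| <= 2 * K / 2 ^+ n.
Proof.
move=> hu.
pose lo n := u n - 2 * K / 2 ^+ n.
pose hi n := u n + 2 * K / 2 ^+ n.
have p2 n : (2 ^+ n.+1 : R)^-1 = (2 ^+ n)^-1 / 2.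
  by rewrite exprS invfM mulrC.
have los n : lo n <= lo n.+1.
  have := hu n; rewrite /lo p2 ler_norml => /andP[]; lra.
have his n : hi n.+1 <= hi n.
  have := hu n; rewrite /hi p2 ler_norml => /andP[]; lra.
have lom : {homo lo : m n / (m <= n)%N >-> m <= n}.
  by apply: homo_leq => // y x z; exact: le_trans.
have him : {homo hi : m n / (m <= n)%N >-> n <= m}.
  by apply: homo_leq => // y x z xy yz; exact: le_trans xy.
have K0 : 0 <= K by have := hu 0%N; rewrite expr0 divr1; exact: le_trans.
have lohi n : lo n <= hi n.
  by rewrite /lo /hi; have : 0 <= K / 2 ^+ n by [rewrite divr_ge0// exprn_ge0]; lra.
have lh m n : lo m <= hi n.
  apply: (le_trans (lom _ _ (leq_maxl m n))).
  by apply: (le_trans (lohi _)); apply: him; exact: leq_maxr.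
exists (sup (range lo)) => n.
have h1 : lo n <= sup (range lo).
  apply: ub_le_sup; last by exists n.
  by exists (hi 0%N) => _ [m _ <-].
have h2 : sup (range lo) <= hi n.
  apply: ge_sup; first by exists (lo 0%N); exists 0%N.
  by move=> _ [m _ <-].
rewrite ler_norml; move: h1 h2; rewrite /lo /hi; lra.
Qed.

(** Archimedean form of letting [n] tend to infinity: for [x > 0] some [n] exceeds [K / x], and
    [n < 2 ^+ n]. *)
Lemma le_geometric_le0 (x K : R) : (forall n, x <= K / 2 ^+ n) -> x <= 0.
Proof.
move=> hx; rewrite leNgt; apply/negP => x0.
have /archi_boundP : 0 <= K / x.
  by rewrite divr_ge0// ?ltW//; have := hx 0%N; rewrite expr0 divr1; lra.
set n := Num.Def.archi_bound _ => hn.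
have := hx n; rewrite ler_pdivlMr ?exprn_gt0// mulrC -ler_pdivlMr// => hk.
have := le_lt_trans hk hn.
by rewrite -natrX ltr_nat ltnNge ltnW// ltn_expl.
Qed.

End Calculus.

(** * Gronwall comparison, a barrier principle and Lipschitz tools *)

Section Comparison.
Variable R : realType.
Local Set Implicit Arguments.
Local Unset Strict Implicit.
Implicit Types (D h : R -> R).

Lemma lipschitz_continuous h M :
  (forall x z : R, `|h x - h z| <= M * `|x - z|) -> continuous h.
Proof.
move=> hM x; apply/cvgrPdist_le => e e0.
have M0 : 0 <= M by have := hM 1 0; rewrite subr0 normr1 mulr1; exact: le_trans.
near=> y.
apply: (le_trans (hM _ _)).
have : `|x - y| <= e / (M + 1).
  near: y; apply: cvgr_dist_le; last by rewrite divr_gt0//; lra.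
  exact: cvg_id.
rewrite ler_pdivlMr; last lra.
have := normr_ge0 (x - y); nra.
Unshelve. all: by end_near. Qed.

Lemma is_derive_expRM (c x : R) :
  is_derive x 1 (fun s => expR (c * s)) (c * expR (c * x)).
Proof.
rewrite mulrC; apply: (@is_derive1_comp _ expR (fun s => c * s)).
by apply: is_derive_eq; rewrite /GRing.scale/= mulr1.
Qed.

(** The squared distance weighted by [expR (c * s)] is nonincreasing for [c = - 2 L] and
    nondecreasing for [c = 2 L]. The first weight carries a zero from [a] to [b], the second from
    [b] to [a], so uniqueness holds in both time directions. *)
Lemma gronwall_endpoints (g1 g2 d1 d2 : R -> R) (a b L : R) : a <= b ->
  {within `[a, b], continuous g1} -> {within `[a, b], continuous g2} ->
  (forall s, a < s < b -> is_derive s 1 g1 (d1 s)) ->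
  (forall s, a < s < b -> is_derive s 1 g2 (d2 s)) ->
  (forall s, a < s < b -> `|d1 s - d2 s| <= L * `|g1 s - g2 s|) ->
  g1 a = g2 a <-> g1 b = g2 b.
Proof.
move=> ab c1 c2 h1 h2 hL.
pose W c s := (g1 s - g2 s) ^+ 2 * expR (c * s).
have Wd c s : a < s < b -> is_derive s 1 (W c)
   ((2 * (g1 s - g2 s) * (d1 s - d2 s) + c * (g1 s - g2 s) ^+ 2) * expR (c * s)).
  move=> sab; have e1 := h1 s sab; have e2 := h2 s sab.
  have e3 : is_derive s 1 ((g1 - g2) ^+ 2)
      ((2%:R * (g1 - g2) s ^+ 1) *: (d1 s - d2 s)).
    by apply: is_deriveX; apply: is_deriveB.
  have := is_deriveM e3 (is_derive_expRM c s).
  have -> : (g1 - g2) ^+ 2 * (fun s => expR (c * s)) = W c.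
    by apply/funext => t; rewrite /W !fctE.
  move=> /is_derive_eq; apply; rewrite /GRing.scale/= !fctE; ring.
have Wc c : {within `[a, b], continuous (W c)}.
  move=> x; apply: cvgM; last first.
    apply: continuous_subspaceT => {}x.
    apply: (@continuous_comp _ _ _ (fun s => c * s) expR).
      by apply: cvgM; [exact: cvg_cst|exact: cvg_id].
    exact: continuous_expR.
  by apply: (@cvg_comp _ _ _ _ (fun t => t ^+ 2)); last exact: exprn_continuous;
     apply: cvgB; [exact: c1|exact: c2].
have dl s : a < s < b ->
    `|2 * (g1 s - g2 s) * (d1 s - d2 s)| <= 2 * L * (g1 s - g2 s) ^+ 2.
  move=> sab; have := hL s sab; rewrite !normrM ger0_norm// -(real_normK (num_real (_ - _))).
  by have := normr_ge0 (g1 s - g2 s); nra.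
have Wz c s : W c s <= 0 -> g1 s = g2 s.
  rewrite /W pmulr_lle0 ?expR_gt0// => h; apply/eqP; rewrite -subr_eq0 -sqrf_eq0.
  by rewrite eq_le h sqr_ge0.
have Wz' c s : g1 s = g2 s -> W c s = 0 by rewrite /W => ->; rewrite subrr expr0n/= mul0r.
split => heq.
- apply: (Wz (- (2 * L))); rewrite -(Wz' (- (2 * L)) _ heq).
  apply: (@ler0_derive1_nincr _ (W (- (2 * L))) a b) => // s; rewrite in_itv/= => sab.
    by case: (Wd (- (2 * L)) s sab).
  rewrite derive1E (@derive_val _ _ _ _ _ _ _ (Wd (- (2 * L)) s sab)).
  rewrite pmulr_lle0 ?expR_gt0//; have := dl s sab; rewrite ler_norml => /andP[]; lra.
- apply: (Wz (2 * L)); rewrite -(Wz' (2 * L) _ heq).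
  apply: (@ger0_derive1_ndecr _ (W (2 * L)) a b) => // s; rewrite in_itv/= => sab.
    by case: (Wd (2 * L) s sab).
  rewrite derive1E (@derive_val _ _ _ _ _ _ _ (Wd (2 * L) s sab)).
  rewrite pmulr_lge0 ?expR_gt0//; have := dl s sab; rewrite ler_norml => /andP[]; lra.
Qed.

Lemma gt0_derive_nmax D (c d b : R) : is_derive c 1 D d -> 0 < d -> c < b ->
  exists2 t, c < t < b & D c < D t.
Proof.
move=> hd d0 cb.
have : (fun h : R => h^-1 *: (D (h *: 1 + c) - D c)) @ 0^' --> d.
  by rewrite -(@derive_val _ _ _ _ _ _ _ hd); exact: (@ex_derive _ _ _ _ _ _ _ hd).
move=> /cvgr_gt /(_ _ d0) [e /= e0 he].
(* The halved minimum is a step that stays strictly inside both the neighbourhood of radius [e] and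
   the interval up to [b]. *)
pose h := Num.min e (b - c) / 2.
have m0 : 0 < Num.min e (b - c) by rewrite lt_min e0 subr_gt0.
have h0 : 0 < h by rewrite divr_gt0.
have hmin : h < Num.min e (b - c) by rewrite /h; lra.
move: hmin; rewrite lt_min => /andP[hle hlb].
have := he h; rewrite /= sub0r normrN gtr0_norm// => /(_ hle (lt0r_neq0 h0)).
rewrite /GRing.scale/= mulr1 pmulr_rgt0 ?invr_gt0// subr_gt0 => Dh.
by exists (h + c) => //; lra.
Qed.

(** The maximum of [D] cannot sit at a point before [b] where [D] is nonnegative, since [D] still
    increases there. As [D a] is nonnegative, the maximum is positive and is attained at [b]. *)
Lemma pos_barrier D dD (a b : R) : a < b ->
  (forall s, a <= s <= b -> is_derive s 1 D (dD s)) ->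
  (forall s, a <= s <= b -> 0 <= D s -> 0 < dD s) ->
  0 <= D a -> 0 < D b.
Proof.
move=> ab hD hpos Da.
have [] := @EVT_max _ D a b (ltW ab).
  apply: derivable_within_continuous => x; rewrite in_itv/= => axb.
  by case: (hD x axb).
move=> c; rewrite in_itv/= => cab hmax.
have nm s : a <= s < b -> 0 <= D s -> exists2 t, t \in `[a, b] & D s < D t.
  move=> /andP[as_ sb] Ds.
  have sab : a <= s <= b by rewrite as_ ltW.
  have [t /andP[st tb] Dt] := gt0_derive_nmax (hD s sab) (hpos s sab Ds) sb.
  by exists t => //; rewrite in_itv/= !ltW// (le_lt_trans as_).
have aab : a <= a < b by rewrite lexx.
have [t tab Dat] := nm a aab Da.
have Dc : 0 < D c by apply: (le_lt_trans Da); apply: (lt_le_trans Dat); exact: hmax.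
move: cab => /andP[ac]; rewrite le_eqVlt => /predU1P[<-//|cb].
have [|u uab Du] := nm c _ (ltW Dc); first by rewrite ac.
by have := hmax u uab; rewrite leNgt Du.
Qed.

Lemma ler_dist_maxr (a x z : R) :
  `|Num.max x a - Num.max z a| <= `|x - z|.
Proof.
rewrite !maxr_absE ler_norml.
have := ler_dist_dist (x - a) (z - a).
have -> : x - a - (z - a) = x - z by ring.
rewrite ler_norml => /andP[h1 h2].
have := ler_norm (x - z); have := ler_norm (z - x); rewrite (distrC z x); lra.
Qed.

Lemma ler_dist_minr (a x z : R) :
  `|Num.min x a - Num.min z a| <= `|x - z|.
Proof.
rewrite !minr_absE ler_norml.
have := ler_dist_dist (x - a) (z - a).
have -> : x - a - (z - a) = x - z by ring.
rewrite ler_norml => /andP[h1 h2].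
have := ler_norm (x - z); have := ler_norm (z - x); rewrite (distrC z x); lra.
Qed.

Lemma continuous_app2 (T : topologicalType) (H : R -> R -> R) (u w : T -> R) :
  continuous (fun p : R * R => H p.1 p.2) -> continuous u -> continuous w ->
  continuous (fun t => H (u t) (w t)).
Proof.
move=> Hc uc wc t.
apply: (@continuous_comp _ _ _ (fun t => (u t, w t)) (fun p : R * R => H p.1 p.2)).
  exact: (cvg_pair (uc t) (wc t)).
exact: Hc.
Qed.

End Comparison.

(** * Global existence on the half-line for a bounded Lipschitz field *)

Section PicardIteration.
Variable R : realType.
Local Set Implicit Arguments.
Local Unset Strict Implicit.
Implicit Types y : R -> R.
Variables (H : R -> R -> R) (L M y0 : R).
Hypotheses (Hc : continuous (fun p : R * R => H p.1 p.2)).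
Hypotheses (HL : forall s x x' : R, `|H s x - H s x'| <= L * `|x - x'|).
Hypotheses (HM : forall s x, `|H s x| <= M) (L0 : 0 < L).

(** The invariant of the iteration: it makes the integrand of [Q] continuous, is preserved by [Q],
    and survives the limit. *)
Let good y := forall s t : R, 0 <= s -> 0 <= t -> `|y s - y t| <= M * `|s - t|.
(** [prim] integrates from -1, where [good] gives no control; [Num.max s 0] freezes [y] at [y 0] for
    negative times and keeps the integrand continuous. *)
Let Q y (t : R) := y0 + prim (fun s : R => H s (y (Num.max s 0))) t.

Let Q0 y : Q y 0 = y0.
Proof. by rewrite /Q prim0 addr0. Qed.

Let Qd y (t : R) : good y -> 0 <= t -> is_derive t 1 (Q y) (H t (y t)).
Proof.
move=> gy t0.
have cy : continuous (fun s : R => y (Num.max s 0)).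
  apply: (@lipschitz_continuous _ (fun s : R => y (Num.max s 0)) M) => s1 s2.
  have m0 (x : R) : 0 <= Num.max x 0 by rewrite le_max lexx orbT.
  apply: (le_trans (gy _ _ (m0 _) (m0 _))).
  apply: ler_wpM2l; first exact: le_trans (HM 0 0).
  exact: ler_dist_maxr.
have -> : H t (y t) = 0 + H t (y (Num.max t 0)) by rewrite add0r max_l.
apply: is_deriveD.
apply: is_derive_prim => //.
by apply: continuous_app2 => // s; exact: cvg_id.
Qed.

Let Qgood y : good y -> good (Q y).
Proof.
move=> gy.
have main (s t : R) : 0 <= s -> s <= t -> `|Q y t - Q y s| <= M * t - M * s.
  move=> s0 st.
  apply: (@derive_le_bound _ (Q y) (fun x => M * x) (fun t => H t (y t)) (fun=> M)) => //.
    by move=> x /andP[sx _]; apply: Qd => //; exact: le_trans sx.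
  by move=> x _; apply: is_derive_eq; rewrite /GRing.scale/= mulr1.
move=> s t s0 t0; case: (leP s t) => st.
  by have := main s t s0 st; rewrite distrC -mulrBr -[t - s]ger0_norm ?subr_ge0// (distrC t).
have := main t s t0 (ltW st).
have ts : 0 <= s - t by rewrite subr_ge0 ltW.
by rewrite (ger0_norm ts) mulrBr.
Qed.

(* The weight exp (2Lt) makes the Picard operator a contraction of ratio 1/2 on
   the whole half-line. *)
Let Qcontract y1 y2 K : good y1 -> good y2 ->
  (forall t : R, 0 <= t -> `|y1 t - y2 t| <= K * expR (2 * L * t)) ->
  forall t : R, 0 <= t -> `|Q y1 t - Q y2 t| <= K / 2 * expR (2 * L * t).
Proof.
move=> g1 g2 h t t0.
have K0 : 0 <= K.
  by have := h 0 (lexx _); rewrite mulr0 expR0 mulr1; exact: le_trans.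
have := @derive_le_bound _ (Q y1 - Q y2) (fun t => K / 2 * expR (2 * L * t))
  (fun t => H t (y1 t) - H t (y2 t)) (fun t => K / 2 * (2 * L * expR (2 * L * t))) 0 t t0.
rewrite !fctE !Q0 subrr subr0 mulr0 expR0 => hb.
apply: (le_trans (hb _ _ _)); last by lra.
- by move=> x /andP[x0 _]; apply: is_deriveB; exact: Qd.
- move=> x _; have e := is_derive_expRM (2 * L) x.
  by apply: is_derive_eq; rewrite /GRing.scale.
- move=> x /andP[x0 _]; apply: (le_trans (HL _ _ _)).
  apply: (@le_trans _ _ (L * (K * expR (2 * L * x)))).
    by rewrite ler_pM2l// h.
  by rewrite le_eqVlt; apply/predU1l; field.
Qed.

Lemma picard_lindelof : exists2 z : R -> R, z 0 = y0 &
  forall t : R, 0 <= t -> is_derive t 1 z (H t (z t)).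
Proof.
pose u n := iter n Q (cst y0).
have M0 : 0 <= M by exact: le_trans (HM 0 0).
have ug n : good (u n).
  elim: n => [|n IH]; last exact: Qgood.
  by move=> s t _ _; rewrite /u/= subrr normr0 mulr_ge0.
(* With this [K] the first increment, at most [M * t = K * (2 * L * t)], is below
   [K * expR (2 * L * t)] by [1 + x <= expR x]. *)
pose K := M / (2 * L).
have hK (t : R) n : 0 <= t -> `|u n.+1 t - u n t| <= K / 2 ^+ n * expR (2 * L * t).
  elim: n t => [|n IH] t t0.
    have h := ug 1%N t 0 t0 (lexx _).
    rewrite (_ : u 1%N 0 = y0) ?subr0 1?(ger0_norm t0) in h; last exact: Q0.
    rewrite expr0 divr1; apply: (le_trans h).
    have -> : M * t = K * (2 * L * t) by rewrite /K; field; rewrite gt_eqF.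
    apply: ler_wpM2l; first by rewrite divr_ge0// mulr_ge0// ltW.
    by have := expR_ge1Dx (2 * L * t); lra.
  have -> : K / 2 ^+ n.+1 = K / 2 ^+ n / 2 by rewrite exprS invfM; ring.
  exact: (Qcontract (ug n.+1) (ug n) IH t0).
have [y hy] : exists y : R -> R, forall t : R, 0 <= t -> forall n,
    `|y t - u n t| <= 2 * K / 2 ^+ n * expR (2 * L * t).
  have /choice[y hy] : forall t : R, exists l, 0 <= t -> forall n,
      `|l - u n t| <= 2 * K / 2 ^+ n * expR (2 * L * t).
    move=> t; case: (leP 0 t) => t0; last by exists 0.
    have [|l hl] := @geometric_limit _ (fun n => u n t) (K * expR (2 * L * t)).
      by move=> n; apply: (le_trans (hK t n t0)); rewrite le_eqVlt; apply/predU1l; ring.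
    by exists l => _ n; apply: (le_trans (hl n)); rewrite le_eqVlt; apply/predU1l; ring.
  by exists y.
have gy : good y.
  move=> s t s0 t0; rewrite -subr_le0.
  apply: (@le_geometric_le0 _ _ (2 * K * expR (2 * L * s) + 2 * K * expR (2 * L * t))) => n.
  have a1 := ug n s t s0 t0; have a2 := hy t t0 n; have a3 := hy s s0 n.
  rewrite [leRHS](_ : _ = 2 * K / 2 ^+ n * expR (2 * L * s) +
    2 * K / 2 ^+ n * expR (2 * L * t)); last by ring.
  have := ler_distD (u n s) (y s) (y t); have := ler_distD (u n t) (u n s) (y t).
  rewrite (distrC (u n t)); lra.
(* Compare both sides with [u n.+1 = Q (u n)]: contraction bounds one distance and the rate of
   convergence the other, each by [K / 2 ^+ n] times the weight. *)
have Qy (t : R) : 0 <= t -> Q y t = y t.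
  move=> t0; apply/eqP; rewrite -subr_eq0 -normr_le0.
  apply: (@le_geometric_le0 _ _ (2 * K * expR (2 * L * t))) => n.
  rewrite [leRHS](_ : _ = 2 * K / 2 ^+ n * expR (2 * L * t)); last by ring.
  have h1 := Qcontract gy (ug n) (fun t t0 => hy t t0 n) t0.
  have h2 := hy t t0 n.+1.
  have := ler_distD (u n.+1 t) (Q y t) (y t); rewrite (distrC (u n.+1 t)).
  have h3 : 2 * K / 2 ^+ n.+1 * expR (2 * L * t) = 2 * K / 2 ^+ n / 2 * expR (2 * L * t).
    by rewrite exprS invfM; ring.
  rewrite h3 in h2.
  move: h1 h2; rewrite [u n.+1 t]/=; lra.
(* The witness is [Q y] because [y] is arbitrary at negative times, while [Q y] has a two-sided
   derivative even at 0. *)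
by exists (Q y) => [|t t0]; [exact: Q0|rewrite Qy//; exact: Qd].
Qed.

End PicardIteration.

(** * Null geodesics as solutions of an ODE: uniqueness, existence and the value of U *)

Section NullGeodesics.
Variable R : realType.
Local Set Implicit Arguments.
Local Unset Strict Implicit.
Implicit Types (G : R -> R -> R) (z : R -> R).

Lemma continuous_rectangle_bounded G (a b c d : R) :
  continuous (fun p : R * R => G p.1 p.2) ->
  exists2 M, 0 < M & forall s x, a <= s <= b -> c <= x <= d -> `|G s x| <= M.
Proof.
move=> Gc.
have K : compact ((fun p : R * R => G p.1 p.2) @` (`[a, b] `*` `[c, d])).
  apply: continuous_compact; first exact: continuous_subspaceT.
  by apply: compact_setX; exact: segment_compact.
have [M [_ hM]] := compact_bounded K.
exists (`|M| + 1) => [|s x sab xcd]; first by rewrite ltr_pwDr.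
apply: (hM (`|M| + 1)); first by rewrite (le_lt_trans (ler_norm M))// ltrDl.
by exists (s, x).
Qed.

Lemma derive_rectangle_lipschitz G (a b c d : R) :
  (forall s x, derivable (G s) x 1) ->
  continuous (fun p : R * R => derive1 (G p.1) p.2) ->
  exists2 L, 0 < L & forall s x y, a <= s <= b -> c <= x <= d -> c <= y <= d ->
    `|G s x - G s y| <= L * `|x - y|.
Proof.
move=> Gd Gdc.
have [L L0 hL] := @continuous_rectangle_bounded (fun s => derive1 (G s)) a b c d Gdc.
exists L => // s x y sab.
wlog xy : x y / x <= y.
  move=> hw xcd ycd; case: (leP x y) => xy; first exact: hw.
  by rewrite distrC [`|x - y|]distrC; apply: hw => //; exact: ltW.
move=> /andP[cx xd] /andP[cy yd].
have [| |t] := @MVT_segment _ (G s) (derive1 (G s)) x y xy.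
- by move=> t _; rewrite derive1E; apply: DeriveDef.
- by apply: derivable_within_continuous => t _.
rewrite in_itv/= => /andP[xt ty] e.
rewrite distrC e normrM (distrC x) ler_wpM2r// hL//.
by rewrite (le_trans cx xt) (le_trans ty yd).
Qed.

Definition clamp (a b x : R) := Num.min (Num.max x a) b.

Lemma clamp_in (a b x : R) : a <= b -> a <= clamp a b x <= b.
Proof.
by move=> ab; rewrite /clamp le_min ge_min le_max !lexx ab !orbT.
Qed.

Lemma clamp_id (a b x : R) : a <= x <= b -> clamp a b x = x.
Proof. by move=> /andP[ax xb]; rewrite /clamp max_l// min_l. Qed.

Lemma clamp_lipschitz (a b x y : R) : `|clamp a b x - clamp a b y| <= `|x - y|.
Proof. exact: le_trans (ler_dist_minr _ _ _) (ler_dist_maxr _ _ _). Qed.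

Lemma clamp_continuous (a b : R) : continuous (clamp a b).
Proof.
apply: (@lipschitz_continuous _ _ 1) => x y; rewrite mul1r; exact: clamp_lipschitz.
Qed.

Section Field.
Variable G : R -> R -> R.
Hypothesis Gc : continuous (fun p : R * R => G p.1 p.2).
Hypothesis Gd : forall s x, derivable (G s) x 1.
Hypothesis Gdc : continuous (fun p : R * R => derive1 (G p.1) p.2).

(** Both curves stay in the rectangle spanned by their extrema, where the field has a Lipschitz
    constant, so the Gronwall comparison applies. *)
Lemma ode_unique z1 z2 (a b : R) : a <= b ->
  {within `[a, b], continuous z1} -> {within `[a, b], continuous z2} ->
  (forall s, a < s < b -> is_derive s 1 z1 (G s (z1 s))) ->
  (forall s, a < s < b -> is_derive s 1 z2 (G s (z2 s))) ->
  z1 a = z2 a <-> z1 b = z2 b.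
Proof.
move=> ab c1 c2 h1 h2.
have [M1 _ hM1] := EVT_max ab c1; have [M2 _ hM2] := EVT_max ab c2.
have [m1 _ hm1] := EVT_min ab c1; have [m2 _ hm2] := EVT_min ab c2.
have [L L0 hL] := @derive_rectangle_lipschitz G a b
  (Num.min (z1 m1) (z2 m2)) (Num.max (z1 M1) (z2 M2)) Gd Gdc.
apply: (gronwall_endpoints (L := L) ab c1 c2 h1 h2) => s /andP[as_ sb].
have sab : s \in `[a, b] by rewrite in_itv/= !ltW.
apply: hL; first by rewrite !ltW.
- by rewrite ge_min le_max hm1// hM1.
- by rewrite ge_min le_max hm2// hM2// !orbT.
Qed.

Lemma backward_clamped_solution (a b c d y0 : R) : a <= b -> c <= d ->
  exists2 z : R -> R, z b = y0 &
    forall s, a <= s <= b -> is_derive s 1 z (G s (clamp c d (z s))).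
Proof.
move=> ab cd.
(* Time is reversed to turn the final condition at [b] into an initial one. It is clamped as well,
   so that the bounds hold on the whole half-line. *)
pose H t x := - G (clamp a b (b - t)) (clamp c d x).
have [M M0 hM] := @continuous_rectangle_bounded G a b c d Gc.
have [L L0 hL] := @derive_rectangle_lipschitz G a b c d Gd Gdc.
have Hc : continuous (fun p : R * R => H p.1 p.2).
  move=> p; apply: cvgN; move: p.
  apply: (@continuous_app2 _ _ G (fun p : R * R => clamp a b (b - p.1))
     (fun p : R * R => clamp c d p.2)) => //.
    move=> p; apply: (@continuous_comp _ _ _ (fun p : R * R => b - p.1) (clamp a b)).
      by apply: cvgB; [exact: cvg_cst|exact: cvg_fst].
    exact: clamp_continuous.
  move=> p; apply: (@continuous_comp _ _ _ (fun p : R * R => p.2) (clamp c d)).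
    exact: cvg_snd.
  exact: clamp_continuous.
have HL s x x' : `|H s x - H s x'| <= L * `|x - x'|.
  rewrite /H -opprD normrN.
  apply: (le_trans (hL _ _ _ (clamp_in _ ab) (clamp_in _ cd) (clamp_in _ cd))).
  by rewrite ler_pM2l// clamp_lipschitz.
have HM s x : `|H s x| <= M.
  by rewrite /H normrN; apply: hM; rewrite clamp_in.
have [z z0 hz] := @picard_lindelof _ H L M y0 Hc HL HM L0.
exists (z \o (fun s => b - s)) => [|s /andP[as_ sb]]; first by rewrite /= subrr.
have bs : 0 <= b - s by rewrite subr_ge0.
have -> : G s (clamp c d ((z \o (fun s => b - s)) s)) = H (b - s) (z (b - s)) * (0 - 1).
  by rewrite /H subKr (@clamp_id a b s) ?as_// sub0r mulrN1 opprK.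
by apply: is_derive1_comp; exact: hz.
Qed.

(** The solution of the clamped equation is shown to stay in the clamping interval, so it solves the
    true equation. *)
Lemma horizon_geodesic_exists (rp : R -> R) (rc v0 v : R) :
  (forall s, derivable rp s 1 /\ derive1 rp s < 0) ->
  (forall s, rc < rp s) ->
  (forall s, G s rc = 0) ->
  (forall s x, rp s <= x -> 0 <= G s x) ->
  v0 <= v ->
  exists z, [/\ z v = rp v,
    forall s, v0 <= s <= v -> is_derive s 1 z (G s (z s)),
    forall s, v0 <= s <= v -> rc < z s &
    forall s, v0 <= s < v -> z s < rp s].
Proof.
move=> hrp hrc Grc Gpos v0v.
have rpd (s t : R) : s <= t -> rp t <= rp s.
  move=> st; apply: (@ler0_derive1_nincr _ rp s t) => //.
  - by move=> x _; case: (hrp x).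
  - by move=> x _; apply: ltW; case: (hrp x).
  - by apply: derivable_within_continuous => x _; case: (hrp x).
have cd : rc <= rp v0 by exact: ltW.
have [z zv hz] := @backward_clamped_solution v0 v rc (rp v0) (rp v) v0v cd.
have [L L0 hL] := @derive_rectangle_lipschitz G v0 v rc (rp v0) Gd Gdc.
have zc (s t : R) : v0 <= s -> t <= v -> {within `[s, t], continuous z}.
  move=> v0s tv; apply: derivable_within_continuous => x; rewrite in_itv/= => /andP[sx xt].
  by have [] := hz x; rewrite ?(le_trans v0s sx) ?(le_trans xt tv).
(* Otherwise [z] meets [rc] at some [t]. The clamped field is still Lipschitz and vanishes at [rc],
   so Gronwall keeps [z] at [rc] until [v], contradicting [z v = rp v]. *)
have zrc s : v0 <= s <= v -> rc < z s.
  move=> /andP[v0s sv]; rewrite ltNge; apply/negP => zs.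
  have [|t] := @IVT _ z s v rc sv (zc _ _ v0s (lexx _)).
    by rewrite zv ge_min le_max zs (ltW (hrc v)) orbT.
  rewrite in_itv/= => /andP[st tv] zt.
  have v0t := le_trans v0s st.
  suff : z v = rc by rewrite zv => e; have := hrc v; rewrite e ltxx.
  have := @gronwall_endpoints _ z (cst rc) (fun s => G s (clamp rc (rp v0) (z s)))
    (fun s => 0) t v L tv (zc _ _ v0t (lexx _)).
  move=> gr; apply/gr => //.
  - by apply: continuous_subspaceT => x; exact: cvg_cst.
  - by move=> x /andP[tx xv]; apply: hz; rewrite (ltW xv) (le_trans v0t) ?ltW.
  - move=> x /andP[tx xv]; rewrite -(Grc x).
    apply: (@le_trans _ _ (L * `|clamp rc (rp v0) (z x) - rc|)).
      by apply: hL; rewrite ?clamp_in ?lexx ?(ltW xv) ?(le_trans v0t) ?ltW.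
    have {2}-> : rc = clamp rc (rp v0) rc by rewrite clamp_id// lexx.
    by rewrite ler_pM2l// clamp_lipschitz.
(* Where [z >= rp], the difference [z - rp] has positive derivative, since the field is nonnegative
   and [rp] decreases. Touching [rp] before [v] would thus force [z v > rp v]. *)
have zrp s : v0 <= s < v -> z s < rp s.
  move=> /andP[v0s sv]; rewrite ltNge; apply/negP => zs.
  suff : 0 < (z - rp) v by rewrite !fctE zv subrr ltxx.
  apply: (@pos_barrier _ (z - rp)
    (fun x => G x (clamp rc (rp v0) (z x)) - derive1 rp x) s v) => //.
  - move=> x /andP[sx xv]; have v0x := le_trans v0s sx.
    apply: is_deriveB; first by apply: hz; rewrite v0x.
    by rewrite derive1E; apply: DeriveDef => //; case: (hrp x).
  - move=> x /andP[sx xv]; rewrite !fctE subr_ge0 => zx.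
    have [_ rx] := hrp x.
    suff : 0 <= G x (clamp rc (rp v0) (z x)) by lra.
    (* Clamping cannot push the radius below [rp x], because its upper end [rp v0] is at least
       [rp x]. *)
    by apply: Gpos; rewrite /clamp le_min le_max zx/= rpd// (le_trans v0s).
  - by rewrite !fctE subr_ge0.
exists z; split => // s sv.
have := hz s sv; rewrite clamp_id// ltW ?zrc//=.
move: sv => /andP[v0s]; rewrite le_eqVlt => /predU1P[->|sv].
  by rewrite zv rpd.
by rewrite (le_trans (ltW (zrp s _)))// ?v0s// rpd.
Qed.
End Field.

(** [xget] returns the intended value once that value is unique. A competing geodesic agrees with
    [z] at its starting time by uniqueness, and positivity of [z] rules out a start at the
    centre. *)
Lemma Ucoord_outgoing (rc v0 v : R) (f A : R -> R -> R) z :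
  let G := fun s x => f s x * A s x / 2 in
  (forall s x, derivable (G s) x 1) ->
  continuous (fun p : R * R => derive1 (G p.1) p.2) ->
  v0 <= v -> outgoing_null_geodesic f A v0 v z ->
  (forall s, v0 <= s <= v -> 0 < z s) ->
  Ucoord rc v0 f A v (z v) = - (2 / pi) * atan (z v0 / rc).
Proof.
move=> G Gd Gdc v0v [zc zd] z0.
have z00 : 0 < z v0 by apply: z0; rewrite lexx.
apply: xget_subset1.
  exists z, v0; split => //; first by rewrite lexx.
    by move=> s /andP[/ltW v0s sv]; apply: z0; rewrite v0s.
  by left.
have uniq u : Uval rc v0 f A v (z v) u -> u = - (2 / pi) * atan (z v0 / rc).
  move=> [g [a [/andP[v0a av] gv [gc gd] g0 hu]]].
  have ga : g a = z a.
    apply/(@ode_unique G Gd Gdc g z a v av gc) => //.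
      by apply: continuous_subspaceW zc; apply: subset_itv; rewrite bnd_simp.
    by move=> s /andP[as_ sv]; apply: zd; rewrite sv (le_lt_trans v0a).
  have za : 0 < z a by apply: z0; rewrite v0a.
  case: hu => [[<- [_ ->]]|[e _]]; first by rewrite ga.
  by move: za; rewrite -ga e ltxx.
by move=> u1 u2 /uniq-> /uniq->.
Qed.
End NullGeodesics.

(** * Regularity of the geodesic field, and the ordering of the horizon values of U *)

Lemma geodesic_field_regular (R : realType) (f A : R -> R -> R) :
  continuous (fun p : R * R => f p.1 p.2) ->
  continuous (fun p : R * R => A p.1 p.2) ->
  (forall v r, derivable (f v) r 1) ->
  (forall v r, derivable (A v) r 1) ->
  continuous (fun p : R * R => derive1 (f p.1) p.2) ->
  continuous (fun p : R * R => derive1 (A p.1) p.2) ->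
  let G := fun s x => f s x * A s x / 2 in
  [/\ continuous (fun p : R * R => G p.1 p.2),
      forall s x, derivable (G s) x 1 &
      continuous (fun p : R * R => derive1 (G p.1) p.2)].
Proof.
move=> fc Ac fd Ad fdc Adc G.
have Gd (s x : R) : is_derive x 1 (G s)
    (2^-1 * (f s x * derive1 (A s) x + A s x * derive1 (f s) x)).
  have hf : is_derive x 1 (f s) (derive1 (f s) x).
    by rewrite derive1E; apply: DeriveDef.
  have hA : is_derive x 1 (A s) (derive1 (A s) x).
    by rewrite derive1E; apply: DeriveDef.
  have -> : G s = 2^-1 *: (f s * A s).
    by apply/funext => t; rewrite /G !fctE /GRing.scale/= mulrC.
  exact: is_deriveZ (is_deriveM hf hA).
split.
- move=> p; apply: cvgM; last exact: cvg_cst.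
  by apply: cvgM; [exact: fc|exact: Ac].
- by move=> s x; case: (Gd s x).
- have -> : (fun p : R * R => derive1 (G p.1) p.2) = (fun p => 2^-1 *
      (f p.1 p.2 * derive1 (A p.1) p.2 + A p.1 p.2 * derive1 (f p.1) p.2)).
    by apply/funext => p; rewrite derive1E (@derive_val _ _ _ _ _ _ _ (Gd _ _)).
  move=> p; apply: cvgM; first exact: cvg_cst.
  by apply: cvgD; apply: cvgM; [exact: fc|exact: Adc|exact: Ac|exact: fdc].
Qed.

Theorem theorem1 (R : realType) (f A F : R -> R -> R) (rp rm : R -> R) (rc v0 : R)
  (* metric functions: positivity, regularity *)
  (HA : forall v r, 0 <= r -> 0 < A v r)
  (Hfc : continuous (fun p : R * R => f p.1 p.2))
  (HAc : continuous (fun p : R * R => A p.1 p.2))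
  (Hfd : forall v r, derivable (f v) r 1)
  (HAd : forall v r, derivable (A v) r 1)
  (Hfdc : continuous (fun p : R * R => derive1 (f p.1) p.2))
  (HAdc : continuous (fun p : R * R => derive1 (A p.1) p.2))
  (* asymptotic flatness and regularity at the centre *)
  (Hfinf : forall v, f v r @[r --> +oo] --> (1 : R))
  (HAinf : forall v, A v r @[r --> +oo] --> (1 : R))
  (Hf0 : forall v, f v 0 = 1)
  (Hdf0 : forall v, derive1 (f v) 0 = 0)
  (HdA0 : forall v, derive1 (A v) 0 = 0)
  (* exactly two apparent horizons r_+ > r_- > 0, f = F (r - r_+)(r - r_-), F > 0 *)
  (Hroots : forall v, 0 < rm v < rp v)
  (HF : forall v r, 0 <= r -> 0 < F v r)
  (Hfact : forall v r, 0 <= r -> f v r = F v r * (r - rp v) * (r - rm v))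
  (* (1) the outer AH moves inward *)
  (Hrp : forall v, derivable rp v 1 /\ derive1 rp v < 0)
  (* (2) both AHs converge to r_c *)
  (Hrpc : rp v @[v --> +oo] --> rc)
  (Hrmc : rm v @[v --> +oo] --> rc)
  (* (4) all r-derivatives of h = A F converge as v -> oo *)
  (Hh : forall (n : nat) r, 0 <= r ->
          cvg ((fun v => derive1n n (fun s => A v s * F v s) r) @ +oo))
  (* Case 1 (which also gives (3)): d r_- / dv = 0 *)
  (Hcase1 : forall v, derivable rm v 1 /\ derive1 rm v = 0) :
  let Up := fun v => Ucoord rc v0 f A v (rp v) in
  let Um := fun v => Ucoord rc v0 f A v (rm v) in
  exists Upinf : R,
    Up v @[v --> +oo] --> Upinf /\
    [/\ -1 < Up v0, Up v0 < Upinf, Upinf <= Um v0, Um v0 < 1 &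
        (Upinf = Um v0 (* Type 1 *) \/ Upinf < Um v0 (* Type 2 *))].
Proof.
move=> Up Um.
have [Gc Gd Gdc] := geodesic_field_regular _ _ _ Hfc HAc Hfd HAd Hfdc HAdc.
set G := fun s x : R => f s x * A s x / 2 in Gc Gd Gdc.
have rmE v : rm v = rc.
  have cst_rm x : rm x = rm v.
    apply: is_derive_0_is_cst => t; have [h1 h2] := Hcase1 t.
    by apply: DeriveDef => //; rewrite -derive1E.
  have h : rm x @[x --> +oo] --> rm v by apply: cvg_near_cst; apply: nearW.
  by rewrite -(cvg_lim _ h)// (cvg_lim _ Hrmc).
have rc0 : 0 < rc by have := Hroots v0; rewrite rmE => /andP[].
have rcp v : rc < rp v by have := Hroots v; rewrite rmE => /andP[].
have Grc s : G s rc = 0 by rewrite /G Hfact ?ltW// rmE subrr mulr0 !mul0r.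
have Gpos s x : rp s <= x -> 0 <= G s x.
  move=> sx; have x0 : 0 <= x by rewrite (le_trans _ sx)// ltW// (lt_trans rc0).
  rewrite /G Hfact// divr_ge0// mulr_ge0 ?(ltW (HA _ _ x0))//.
  rewrite !mulr_ge0 ?(ltW (HF _ _ x0))// subr_ge0// rmE.
  by rewrite (le_trans _ sx)// ltW.
have geo (v : R) : v0 <= v -> exists z, [/\ z v = rp v,
    forall s : R, v0 <= s <= v -> is_derive s 1 z (G s (z s)),
    forall s : R, v0 <= s <= v -> rc < z s &
    forall s, v0 <= s < v -> z s < rp s].
  exact: horizon_geodesic_exists.
have zc (z : R -> R) (a b : R) : (forall s : R, a <= s <= b -> is_derive s 1 z (G s (z s))) ->
    {within `[a, b], continuous z}.
  move=> hz; apply: derivable_within_continuous => s; rewrite in_itv/= => sab.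
  by case: (hz s sab).
have UpE (v : R) (z : R -> R) : v0 <= v -> z v = rp v ->
    (forall s : R, v0 <= s <= v -> is_derive s 1 z (G s (z s))) ->
    (forall s : R, v0 <= s <= v -> rc < z s) ->
    Up v = - (2 / pi) * atan (z v0 / rc).
  move=> v0v zv hz zrc; rewrite /Up -zv; apply: Ucoord_outgoing => //.
    split; first exact: zc.
    by move=> s /andP[v0s sv]; apply: hz; rewrite !ltW.
  by move=> s sv; apply: (lt_trans rc0); exact: zrc.
(* The time interval is the single point [v0], so the constant curve satisfies the equation over an
   empty open interval. *)
have UmE : Um v0 = - (2 / pi) * atan (rc / rc).
  rewrite /Um rmE; apply: (@Ucoord_outgoing _ rc v0 v0 f A (cst rc)) => //.
  split; first by apply: continuous_subspaceT => s; exact: cvg_cst.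
  by move=> s /andP[h1 h2]; have := lt_trans h1 h2; rewrite ltxx.
have pi2 : 0 < 2 / pi :> R by rewrite divr_gt0// pi_gt0.
have Ulem (x y : R) : x < y -> - (2 / pi) * atan (y / rc) < - (2 / pi) * atan (x / rc).
  by move=> xy; rewrite !mulNr ltrN2 ltr_pM2l// lt_atan// ltr_pM2r// invr_gt0.
(* At [v1] the later geodesic [z2] is strictly below the horizon point [z1 v1]. If it were not below
   [z1] at [v0], the two would cross, and uniqueness would make them agree at [v1]. *)
have Up_lt v1 v2 : v0 <= v1 -> v1 < v2 -> Up v1 < Up v2.
  move=> v01 v12; have v02 : v0 <= v2 by rewrite ltW// (le_lt_trans v01).
  have [z1 [e1 d1 c1 p1]] := geo _ v01; have [z2 [e2 d2 c2 p2]] := geo _ v02.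
  rewrite (UpE v1 z1)// (UpE v2 z2)//; apply: Ulem; rewrite ltNge; apply/negP => z12.
  have z21 : z2 v1 < z1 v1 by rewrite e1 p2// v01.
  have d2' s : v0 <= s <= v1 -> is_derive s 1 z2 (G s (z2 s)).
    by move=> /andP[v0s sv]; apply: d2; rewrite v0s (le_trans sv)// ltW.
  have [||t] := @IVT _ (z2 - z1) v0 v1 0 v01.
  - apply: derivable_within_continuous => s; rewrite in_itv/= => sv.
    by have := d1 s sv; have := d2' s sv => h1 h2; apply: derivableB.
  - by rewrite ge_min le_max !fctE !subr_ge0 !subr_le0 z12 (ltW z21) orbT.
  rewrite in_itv/= !fctE => /andP[v0t tv1] /eqP; rewrite subr_eq0 => /eqP zt.
  have sub s : t <= s <= v1 -> v0 <= s <= v1.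
    by move=> /andP[ts ->]; rewrite (le_trans v0t).
  have := @ode_unique _ G Gd Gdc z2 z1 t v1 tv1.
  move=> [||||/(_ zt) e _].
  - by apply: zc => s /sub; exact: d2'.
  - by apply: zc => s /sub; exact: d1.
  - by move=> s /andP[ts sv]; apply: d2'; apply: sub; rewrite !ltW.
  - by move=> s /andP[ts sv]; apply: d1; apply: sub; rewrite !ltW.
  by move: z21; rewrite e ltxx.
have Up_le_Um v : v0 <= v -> Up v <= Um v0.
  move=> v0v; have [z [e d c p]] := geo _ v0v.
  by rewrite (UpE v z)// UmE; apply/ltW/Ulem/c; rewrite lexx.
(* Monotonicity of [Up] is known only from [v0] on; freezing it earlier gives a function
   nondecreasing on the whole line, with the same limit. *)
pose Phi v := Up (Num.max v v0).
have v0m v : v0 <= Num.max v v0 by rewrite le_max lexx orbT.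
have Phi_cvg : Phi v @[v --> +oo] --> sup (range Phi).
  apply: nondecreasing_cvgr => [v1 v2 v12|].
    rewrite /Phi; have : Num.max v1 v0 <= Num.max v2 v0.
      by rewrite ge_max v0m le_max v12.
    by rewrite le_eqVlt => /predU1P[->//|h]; apply/ltW/Up_lt.
  by exists (Um v0) => _ [v _ <-]; exact: Up_le_Um.
have supU : sup (range Phi) <= Um v0.
  apply: ge_sup; first by exists (Phi v0); exists v0.
  by move=> _ [v _ <-]; exact: Up_le_Um.
exists (sup (range Phi)); split.
  apply: cvg_trans Phi_cvg; apply: near_eq_cvg; near=> v.
  by rewrite /Phi max_l//; near: v; exact: nbhs_pinfty_ge.
split => //.
- have v00 : v0 <= v0 by [].
  have [z [e d c p]] := geo _ v00.
  rewrite (UpE v0 z)// mulNr ltrN2.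
  have := atan_ltpi2 (z v0 / rc); have := pi_gt0 R => p0.
  by rewrite -ltr_pdivlMl// mulr1 invf_div.
(* The intermediate time [v0 + 1] keeps the inequality strict when passing to the supremum. *)
- have v01 : v0 < v0 + 1 by rewrite ltrDl.
  apply: (lt_le_trans (Up_lt _ _ (lexx _) v01)).
  apply: ub_le_sup; first by exists (Um v0) => _ [v _ <-]; exact: Up_le_Um.
  by exists (v0 + 1) => //; rewrite /Phi max_l// ltW.
- rewrite UmE divff ?gt_eqF// atan1.
  have := pi_gt0 R => p0; apply: (@lt_trans _ _ 0) => //.
  by rewrite mulNr oppr_lt0 mulr_gt0// divr_gt0.
- by move: supU; rewrite le_eqVlt => /predU1P[]; [left|right].
Unshelve. all: by end_near. Qed.
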